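(* Let $R$ be an associative and commutative ring with identity containing $\mathbb{Q}=\mathbb{Q}\cdot 1$, and let $m,n\ge 1$. Let $C=R\{y_1,\ldots,y_n\}$ be the differential polynomial algebra over $R$ with respect to $\Delta=\{\delta_1,\ldots,\delta_{2m}\}$, and let ${\bf P}_n$ be the subalgebra of the Poisson algebra $P(C)$ generated by $y_1,\ldots,y_n$. Then the Poisson algebra ${\bf P}_n$ is the free algebra of the variety of algebras $\mathrm{Var}(P_m)$ freely generated by $y_1,\ldots,y_n$.
   Context: A differential algebra over $R$ is a commutative associative $R$-algebra with identity with pairwise commuting $R$-linear derivations $\delta_1,\ldots,\delta_{2m}$ ($R$ itself has $\delta_i(R)=0$). The differential polynomial algebra $R\{y_1,\ldots,y_n\}$ is the polynomial algebra over $R$ in the independent variables $y_i^{\theta}$ ($1\le i\le n$, $\theta\in\Theta$, where $\Theta$ is the free commutative monoid on $\Delta$), with $\delta_k(y_i^\theta)=y_i^{\delta_k\theta}$ and $\delta_k(R)=0$. For a differential $R$-algebra $A$, $P(A)$ denotes the Poisson algebra $\langle A,\cdot,\{\cdot,\cdot\}\rangle$, where $\cdot$ is the multiplication of $A$ and $$\{f,g\}=\sum_{i=1}^m\bigl(\delta_{2i-1}(f)\delta_{2i}(g)-\delta_{2i}(f)\delta_{2i-1}(g)\bigr).$$ $C_{2m}=R[x_1,\ldots,x_{2m}]$ is the polynomial algebra with derivations $\delta_i=\partial/\partial x_i$, and $P_m=P(C_{2m})$ is the symplectic Poisson algebra of index $m$ over $R$. $\mathrm{Var}(P_m)$ is the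 variety of (Poisson) algebras over $R$ generated by $P_m$. *)

(* Defs.v *)
From HB Require Import structures.
From mathcomp Require Import all_boot all_order all_algebra.
From mathcomp Require Import finmap boolp.
From mathcomp Require Import ring.
From mathcomp Require Import mpoly.
From mathcomp Require monalg.

Set Implicit Arguments.
Unset Strict Implicit.
Unset Printing Implicit Defensive.

Import GRing.Theory.
Local Open Scope ring_scope.

(* Algebras over R in the signature (., {,}): an R-module with two bilinear   *)
(* operations. No axiom is imposed on the operations, since the identities of *)
(* Poisson algebras are part of what defines a variety of Poisson algebras    *)
(* (see Var_poisson below). The identity element is not in the signature.     *)
Record algebra2 (R : comNzRingType) := Algebra2 {
  carrier :> lmodType R;
  amul : carrier -> carrier -> carrier;
  abr : carrier -> carrier -> carrier;
  amul_bilinear : bilinear_for *:%R *:%R amul;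
  abr_bilinear : bilinear_for *:%R *:%R abr }.

Record is_poisson (R : comNzRingType) (A : algebra2 R) : Prop := IsPoisson {
  poisson_mulA : associative (@amul R A);
  poisson_mulC : commutative (@amul R A);
  poisson_brxx : forall a : A, abr a a = 0;
  poisson_jacobi : forall a b c : A,
    abr a (abr b c) + abr b (abr c a) + abr c (abr a b) = 0;
  poisson_leibniz : forall a b c : A,
    abr (amul a b) c = amul a (abr b c) + amul (abr a c) b }.

Record is_hom (R : comNzRingType) (A B : algebra2 R) (f : A -> B) : Prop :=
  IsHom {
    hom_linear : linear f;
    hom_mul : {morph f : a b / amul a b >-> amul a b};
    hom_br : {morph f : a b / abr a b >-> abr a b} }.

Section Varieties.
Variable R : comNzRingType.

(* Terms represent the elements of the absolutely free algebra with two       *)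
(* bilinear operations over R on countably many variables; the term t stands  *)
(* for the identity t = 0.                                                    *)
Inductive term : Type :=
| TVar of nat
| TZero
| TAdd of term & term
| TScale of R & term
| TMul of term & term
| TBr of term & term.

Fixpoint eval (A : algebra2 R) (v : nat -> A) (t : term) : A :=
  match t with
  | TVar k => v k
  | TZero => 0
  | TAdd t1 t2 => eval v t1 + eval v t2
  | TScale a t1 => a *: eval v t1
  | TMul t1 t2 => amul (eval v t1) (eval v t2)
  | TBr t1 t2 => abr (eval v t1) (eval v t2)
  end.

Definition satisfies (A : algebra2 R) (t : term) : Prop :=
  forall v : nat -> A, eval v t = 0.

Definition variety (S : term -> Prop) (A : algebra2 R) : Prop :=
  forall t : term, S t -> satisfies A t.

(* The smallest variety containing B.                                         *)
Definition Var (B : algebra2 R) : algebra2 R -> Prop := variety (satisfies B).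

(* generated y: the smallest subalgebra containing all y i.                   *)
Inductive generated (A : algebra2 R) (I : Type) (y : I -> A) : A -> Prop :=
| gen_var i : generated y (y i)
| gen_zero : generated y 0
| gen_add a b : generated y a -> generated y b -> generated y (a + b)
| gen_scale r a : generated y a -> generated y (r *: a)
| gen_mul a b : generated y a -> generated y b -> generated y (amul a b)
| gen_br a b : generated y a -> generated y b -> generated y (abr a b).

Definition is_free (V : algebra2 R -> Prop) (I : Type) (F : algebra2 R)
    (y : I -> F) : Prop :=
  [/\ V F,
      forall x : F, generated y x
    & forall (A : algebra2 R) (a : I -> A), V A ->
        exists f : F -> A,
          [/\ is_hom f, forall i, f (y i) = a i
            & forall g : F -> A, is_hom g -> (forall i, g (y i) = a i) ->
                g =1 f]].

Lemma Var_poisson (A B : algebra2 R) : is_poisson B -> Var B A -> is_poisson A.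
Proof.
move=> PB VA.
pose x := TVar 0; pose y := TVar 1; pose z := TVar 2.
pose sub t u := TAdd t (TScale (- 1) u).
pose w (a b c : A) k := if k is k'.+1 then if k' is 0%N then b else c else a.
have E t : (forall v : nat -> B, eval v t = 0) ->
    forall a b c : A, eval (w a b c) t = 0.
  by move=> tB a b c; apply: (VA t tB).
split=> [a b c|a b|a|a b c|a b c].
- have := E (sub (TMul x (TMul y z)) (TMul (TMul x y) z)) _ a b c.
  rewrite /= scaleN1r => e; apply/eqP; rewrite -subr_eq0 e //= => v.
  by rewrite scaleN1r (poisson_mulA PB) subrr.
- have := E (sub (TMul x y) (TMul y x)) _ a b a.
  rewrite /= scaleN1r => e; apply/eqP; rewrite -subr_eq0 e //= => v.
  by rewrite scaleN1r (poisson_mulC PB) subrr.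
- by apply: (E (TBr x x) _ a a a) => v /=; apply: (poisson_brxx PB).
- apply: (E (TAdd (TAdd (TBr x (TBr y z)) (TBr y (TBr z x)))
                  (TBr z (TBr x y))) _ a b c) => v /=.
  exact: (poisson_jacobi PB).
- have := E (sub (TBr (TMul x y) z)
                 (TAdd (TMul x (TBr y z)) (TMul (TBr x z) y))) _ a b c.
  rewrite /= scaleN1r => e; apply/eqP; rewrite -subr_eq0 e //= => v.
  by rewrite scaleN1r (poisson_leibniz PB) subrr.
Qed.

Section Subalgebra.
Variables (A : algebra2 R) (I : Type) (y : I -> A).

Definition gen_pred : {pred A} := fun x => `[< generated y x >].

Lemma gen_predP x : reflect (generated y x) (x \in gen_pred).
Proof. exact: asboolP. Qed.

Lemma gen_pred_closed : submod_closed gen_pred.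
Proof.
split=> [|r a b /gen_predP ga /gen_predP gb]; apply/gen_predP.
  exact: gen_zero.
by apply: gen_add => //; apply: gen_scale.
Qed.

HB.instance Definition _ := GRing.isSubmodClosed.Build R A gen_pred
  gen_pred_closed.

Record gen_type := GenType { gen_val :> A; gen_valP : gen_val \in gen_pred }.

HB.instance Definition _ := [isSub for gen_val].
HB.instance Definition _ := [Choice of gen_type by <:].
HB.instance Definition _ := [SubChoice_isSubLmodule of gen_type by <:].

Lemma gen_mulP (a b : gen_type) : amul (val a) (val b) \in gen_pred.
Proof.
by apply/gen_predP/gen_mul; apply/gen_predP; exact: valP.
Qed.

Lemma gen_brP (a b : gen_type) : abr (val a) (val b) \in gen_pred.
Proof.
by apply/gen_predP/gen_br; apply/gen_predP; exact: valP.
Qed.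

Definition gen_amul (a b : gen_type) : gen_type := GenType (gen_mulP a b).
Definition gen_abr (a b : gen_type) : gen_type := GenType (gen_brP a b).

Lemma gen_amul_bilinear : bilinear_for *:%R *:%R gen_amul.
Proof.
have [hl hr] := @amul_bilinear R A.
by split=> u r a b; apply: val_inj; [apply: hl | apply: hr].
Qed.

Lemma gen_abr_bilinear : bilinear_for *:%R *:%R gen_abr.
Proof.
have [hl hr] := @abr_bilinear R A.
by split=> u r a b; apply: val_inj; [apply: hl | apply: hr].
Qed.

Definition subalgebra : algebra2 R :=
  Algebra2 gen_amul_bilinear gen_abr_bilinear.

Lemma gen_var_in i : y i \in gen_pred.
Proof. by apply/gen_predP/gen_var. Qed.

Definition subalgebra_gen (i : I) : subalgebra := GenType (gen_var_in i).

End Subalgebra.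

End Varieties.

(* Differential algebras with q pairwise commuting derivations.               *)
Record diffAlgebra (R : comNzRingType) (q : nat) := DiffAlgebra {
  dcarrier :> comAlgType R;
  der : 'I_q -> {linear dcarrier -> dcarrier};
  der_leibniz : forall k (a b : dcarrier),
    der k (a * b) = der k a * b + a * der k b;
  der_comm : forall k l (a : dcarrier), der k (der l a) = der l (der k a) }.

(* With indices counted from 0, the pair (2i-1, 2i), 1 <= i <= m, of indices  *)
(* counted from 1 becomes (2i, 2i+1), i < m.                                  *)
Lemma idx0_subproof m (i : 'I_m) : (i.*2 < m.*2)%N.
Proof. by rewrite ltn_double. Qed.

Lemma idx1_subproof m (i : 'I_m) : (i.*2.+1 < m.*2)%N.
Proof. by rewrite ltn_Sdouble. Qed.

Definition idx0 m (i : 'I_m) : 'I_m.*2 := Ordinal (idx0_subproof i).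
Definition idx1 m (i : 'I_m) : 'I_m.*2 := Ordinal (idx1_subproof i).

Section PoissonOfDiff.
Variables (R : comNzRingType) (m : nat) (A : diffAlgebra R m.*2).

Definition dbracket (f g : A) : A :=
  \sum_(i < m) (der A (idx0 i) f * der A (idx1 i) g
                - der A (idx1 i) f * der A (idx0 i) g).

Lemma dmul_bilinear : bilinear_for *:%R *:%R (@GRing.mul A).
Proof.
by split=> u r a b; rewrite ?mulrDl ?mulrDr -?scalerAl -?scalerAr.
Qed.

Lemma dbracket_bilinear : bilinear_for *:%R *:%R dbracket.
Proof.
split=> u r a b; rewrite /dbracket /= scaler_sumr -big_split /=;
  apply: eq_bigr => i _; rewrite !linearP /= scalerBr ?mulrDl ?mulrDr
    -?scalerAl -?scalerAr opprD !addrA; congr (_ + _); by rewrite addrAC.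
Qed.

Definition poisson : algebra2 R := Algebra2 dmul_bilinear dbracket_bilinear.

Lemma poisson_is_poisson : is_poisson poisson.
Proof.
split=> [a b c|a b|a|a b c|a b c].
- exact: mulrA.
- exact: mulrC.
- by rewrite /= /dbracket big1 // => i _; rewrite mulrC subrr.
- pose D0 i := der A (idx0 i); pose D1 i := der A (idx1 i).
  pose Q (u v w : A) (i j : 'I_m) :=
    D0 i u * D1 i (D0 j v) * D1 j w - D0 i u * D1 i (D1 j v) * D0 j w
    - D1 i u * D0 i (D0 j v) * D1 j w + D1 i u * D0 i (D1 j v) * D0 j w.
  pose SQ u v w := \sum_i \sum_j Q u v w i j.
  have SQC u v w : SQ u v w = SQ w v u.
    rewrite /SQ exchange_big /=; apply: eq_bigr => i _; apply: eq_bigr => j _.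
    by rewrite /Q /D0 /D1 !(der_comm (idx0 j)) !(der_comm (idx1 j)); ring.
  have E u v w : dbracket u (dbracket v w) = SQ u v w - SQ u w v.
    rewrite /SQ -sumrB; apply: eq_bigr => i _; rewrite -sumrB.
    rewrite /dbracket !raddf_sum /= !mulr_sumr -sumrB; apply: eq_bigr => j _.
    by rewrite !raddfB /= !der_leibniz /Q /D0 /D1; ring.
  rewrite /= !E (SQC b c a) (SQC c a b) (SQC c b a).
  by ring.
- rewrite /= /dbracket mulr_sumr mulr_suml -big_split /=.
  by apply: eq_bigr => i _; rewrite !der_leibniz; ring.
Qed.

End PoissonOfDiff.

Section Symplectic.
Variables (R : comNzRingType) (m : nat).

Definition polyDiff : diffAlgebra R m.*2 :=
  @DiffAlgebra R m.*2 {mpoly R[m.*2]} (fun k => mderiv k)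
    (fun k => mderivM k) (fun k l => mderiv_comm l k).

Definition symplectic : algebra2 R := poisson polyDiff.
End Symplectic.

Section DerivationExtension.
Variables (R : comNzRingType) (A : comAlgType R).

Lemma leibniz_ext (T : Type) (M : T -> A)
    (A_ind : forall P : A -> Prop, P 0 ->
       (forall a b, P a -> P b -> P (a + b)) ->
       (forall r a, P a -> P (r *: a)) ->
       (forall t, P (M t)) -> forall a, P a)
    (D : {linear A -> A}) :
    (forall s t, D (M s * M t) = D (M s) * M t + M s * D (M t)) ->
  forall a b, D (a * b) = D a * b + a * D b.
Proof.
move=> H a b; elim/A_ind: a => [|a a' ha ha'|r a ha|s].
- by rewrite mul0r raddf0 !mul0r addr0.
- by rewrite mulrDl !raddfD /= ha ha' !mulrDl addrACA.
- by rewrite -scalerAl !linearZ /= ha scalerDr -!scalerAl.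
elim/A_ind: b => [|b b' hb hb'|r b hb|t]; last exact: H.
- by rewrite mulr0 raddf0 !mulr0 addr0.
- by rewrite mulrDr !raddfD /= hb hb' !mulrDr addrACA.
- by rewrite -scalerAr !linearZ /= hb scalerDr -!scalerAr.
Qed.

Lemma der_comm_mul (D D' : {linear A -> A}) :
    (forall a b, D (a * b) = D a * b + a * D b) ->
    (forall a b, D' (a * b) = D' a * b + a * D' b) ->
  forall a b, D (D' a) = D' (D a) -> D (D' b) = D' (D b) ->
    D (D' (a * b)) = D' (D (a * b)).
Proof.
move=> DM D'M a b ha hb.
by rewrite D'M DM !raddfD /= !DM !D'M ha hb; ring.
Qed.

Lemma der_comm_ext (T : Type) (M : T -> A)
    (A_ind : forall P : A -> Prop, P 0 ->
       (forall a b, P a -> P b -> P (a + b)) ->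
       (forall r a, P a -> P (r *: a)) ->
       (forall t, P (M t)) -> forall a, P a)
    (D D' : {linear A -> A}) :
  (forall t, D (D' (M t)) = D' (D (M t))) -> forall a, D (D' a) = D' (D a).
Proof.
move=> H a; elim/A_ind: a => [|a a' ha ha'|r a ha|t]; last exact: H.
- by rewrite !raddf0.
- by rewrite !raddfD /= ha ha'.
- by rewrite !linearZ /= ha.
Qed.

End DerivationExtension.

(* The free commutative monoid on delta_0, ..., delta_(q-1), as multi-indices *)
(* written additively.                                                        *)
Definition Theta (q : nat) : choiceType := 'X_{1..q}.

Definition delta_mul q (k : 'I_q) (theta : Theta q) : Theta q :=
  (U_(k) + theta)%MM.

Import monalg.

Section DiffPoly.
Variables (R : comNzRingType) (n q : nat).

(* The pair (i, theta) stands for the variable y_i^theta.                     *)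
Definition dvar : choiceType := ('I_n * Theta q)%type.

Local Notation dpoly := {malg R[{cmonom dvar}]}.

Definition dX (v : dvar) : dpoly := << ucm v >>.

Definition dshift (k : 'I_q) (v : dvar) : dvar := (v.1, delta_mul k v.2).

(* The Leibniz rule forces delta_k mu = sum_v (mu v) (mu / v) (delta_k v) on  *)
(* a monomial mu, v ranging over the variables that occur in mu.              *)
Definition dder_mon (k : 'I_q) (mu : {cmonom dvar}) : dpoly :=
  \sum_(v <- finsupp mu) (<< divcm mu (ucm v) >> * dX (dshift k v)) *+ mu v.

Definition dder (k : 'I_q) (p : dpoly) : dpoly :=
  \sum_(mu <- msupp p) mcoeff mu p *: dder_mon k mu.

Lemma dderE k (d : {fset {cmonom dvar}}) (p : dpoly) :
  (msupp p `<=` d)%fset -> dder k p = \sum_(mu <- d) mcoeff mu p *: dder_mon k mu.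
Proof.
move=> le; rewrite /dder (big_fset_incl _ le) // => mu _ nmu.
by rewrite mcoeff_outdom // scale0r.
Qed.

Lemma dder_linear k : linear (dder k).
Proof.
move=> r p p'; pose d := (msupp p `|` msupp p')%fset.
have lp : (msupp p `<=` d)%fset by apply: fsubsetUl.
have lp' : (msupp p' `<=` d)%fset by apply: fsubsetUr.
have ls : (msupp (r *: p + p') `<=` d)%fset.
  apply: fsubset_trans (msuppD_le _ _) _; rewrite fsubUset lp' andbT.
  exact: fsubset_trans (msuppZ_le _ _) lp.
rewrite (dderE k lp) (dderE k lp') (dderE k ls) scaler_sumr -big_split /=.
by apply: eq_bigr => mu _; rewrite mcoeffD mcoeffZ scalerDl scalerA.
Qed.

HB.instance Definition _ k :=
  GRing.isLinear.Build R dpoly dpoly *:%R (dder k) (dder_linear k).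

Lemma dder_mu k mu : dder k << mu >> = dder_mon k mu.
Proof. by rewrite (dderE k msuppU_le) big_seq_fset1 mcoeffUU scale1r. Qed.

Lemma dder_monE k (d : {fset dvar}) (mu : {cmonom dvar}) :
  (finsupp mu `<=` d)%fset ->
  dder_mon k mu =
    \sum_(v <- d) (<< divcm mu (ucm v) >> * dX (dshift k v)) *+ mu v.
Proof.
move=> le; rewrite /dder_mon (big_fset_incl _ le) // => v _.
by rewrite -cmE_eq0 => /eqP ->; rewrite mulr0n.
Qed.

Lemma dmonM (mu nu : {cmonom dvar}) :
  << mmul mu nu >> = << mu >> * << nu >> :> dpoly.
Proof. by rewrite malgM_def fgmulUU mulr1. Qed.

Lemma dder_monM k (mu nu : {cmonom dvar}) :
  dder_mon k (mmul mu nu) = dder_mon k mu * << nu >> + << mu >> * dder_mon k nu.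
Proof.
pose d := (finsupp mu `|` finsupp nu)%fset.
have lm : (finsupp mu `<=` d)%fset by apply: fsubsetUl.
have ln : (finsupp nu `<=` d)%fset by apply: fsubsetUr.
have ls : (finsupp (mmul mu nu) `<=` d)%fset by rewrite mdomD.
rewrite (dder_monE k lm) (dder_monE k ln) (dder_monE k ls).
rewrite [X in X + _]mulr_suml.
rewrite [X in _ + X]mulr_sumr.
rewrite -big_split /=.
apply: eq_bigr => v _.
rewrite cmM [LHS]mulrnDr; congr (_ + _).
- rewrite [RHS]mulrnAl; have [->|mv] := posnP (mu v).
    by rewrite [LHS]mulr0n [RHS]mulr0n.
  have -> : divcm (mmul mu nu) (ucm v) = mmul (divcm mu (ucm v)) nu.
    apply/eqP/cmP => w; rewrite cmM !divcmE cmM cmU.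
    by case: eqP => [<-|_]; [rewrite addnBAC | rewrite !subn0].
  by rewrite dmonM [in LHS]mulrAC.
- rewrite [RHS]mulrnAr; have [->|nv] := posnP (nu v).
    by rewrite [LHS]mulr0n [RHS]mulr0n.
  have -> : divcm (mmul mu nu) (ucm v) = mmul mu (divcm nu (ucm v)).
    apply/eqP/cmP => w; rewrite cmM !divcmE cmM cmU.
    by case: eqP => [<-|_]; [rewrite addnBA | rewrite !subn0].
  by rewrite dmonM [X in _ = X *+ _]mulrA.
Qed.

Lemma dpoly_ind (P : dpoly -> Prop) :
  P 0 -> (forall p p', P p -> P p' -> P (p + p')) ->
  (forall r p, P p -> P (r *: p)) -> (forall mu, P << mu >>) -> forall p, P p.
Proof.
move=> P0 PD PZ PM p; rewrite (monalgE p).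
apply: (big_ind P) => // mu _.
have -> : << (mcoeff mu p) *g mu >> = mcoeff mu p *: (<< mu >> : dpoly).
  by apply/malgP => nu; rewrite [LHS]mcoeffU [RHS]mcoeffZ mcoeffU1 mulr_natr.
exact: PZ.
Qed.

Lemma dder_leibniz k (a b : dpoly) :
  dder k (a * b) = dder k a * b + a * dder k b.
Proof.
apply: (@leibniz_ext R dpoly _ (fun mu => << mu >>) dpoly_ind (dder k)).
move=> mu nu; rewrite -dmonM [LHS]dder_mu.
by rewrite [X in _ = X * _ + _]dder_mu [X in _ = _ + _ * X]dder_mu dder_monM.
Qed.

Lemma dder_X k v : dder k (dX v) = dX (dshift k v).
Proof.
rewrite /dX dder_mu /dder_mon mdomU big_seq_fset1 cmUU mulr1n.
have -> : divcm (ucm v) (ucm v) = mone.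
  by apply/eqP/cmP => w; rewrite divcmE subnn cm1.
by rewrite [<< mone >>](_ : _ = 1) ?mul1r.
Qed.

Lemma dder_1 k : dder k << mone >> = 0.
Proof. by rewrite dder_mu /dder_mon mdom1 big_seq_fset0. Qed.

Lemma dder_comm k l (a : dpoly) : dder k (dder l a) = dder l (dder k a).
Proof.
apply: (@der_comm_ext R dpoly _ (fun mu => << mu >>) dpoly_ind
          (dder k) (dder l)) => mu.
have [d] := ubnP (mdeg mu); elim: d mu => [mu|d IH mu].
  by rewrite ltn0 => /notF[].
rewrite ltnS => le.
have [->|nmu] := eqVneq mu mone.
  by rewrite [X in _ X = _]dder_1 [X in _ = _ X]dder_1 !raddf0.
have [v vmu] : exists v, v \in finsupp mu.
  apply/fset0Pn; apply: contra nmu => /eqP e; rewrite -mdeg_eq0 mdegE e.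
  by rewrite big_seq_fset0.
pose nu := divcm mu (ucm v).
have e : mu = mmul (ucm v) nu.
  apply/eqP/cmP => w; rewrite cmM divcmE cmU.
  by case: eqP => [<-|_]; [rewrite subnKC // lt0n cmE_neq0 | rewrite subn0].
rewrite e dmonM; apply: (@der_comm_mul R dpoly (dder k) (dder l)).
- exact: dder_leibniz.
- exact: dder_leibniz.
- rewrite -/(dX v) [X in _ X = _]dder_X [X in _ = _ X]dder_X.
  rewrite [LHS]dder_X [RHS]dder_X; congr dX.
  by rewrite /dshift /= /delta_mul !mpoly.addmA (mpoly.addmC (mnm1 k)).
- apply: (IH nu); rewrite (leq_trans _ le) //.
  by rewrite e mdegM mdegU add1n.
Qed.

Definition diffPoly : diffAlgebra R q :=
  @DiffAlgebra R q dpoly (fun k => dder k) dder_leibniz dder_comm.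

Definition diffPoly_var (i : 'I_n) : diffPoly := dX (i, (0%MM : Theta q)).

End DiffPoly.

Section FreePoisson.
Variables (R : comNzRingType) (m n : nat).

Definition Pn : algebra2 R :=
  subalgebra (@diffPoly_var R n m.*2 : 'I_n -> poisson (diffPoly R n m.*2)).

Definition Pn_var : 'I_n -> Pn :=
  subalgebra_gen
    (@diffPoly_var R n m.*2 : 'I_n -> poisson (diffPoly R n m.*2)).

End FreePoisson.

(* Main.v *)
(* Each choice of polynomials f_1, ..., f_n extends to a differential
   homomorphism from R{y_1, ..., y_n} to R[x_1, ..., x_2m] sending y_i to f_i,
   which restricts to a Poisson homomorphism from P_n to P_m. So every
   relation that holds between the y_i in P_n is an identity of P_m; this
   gives the universal property. Conversely, these homomorphisms separate the
   points of R{y_1, ..., y_n}, so that P_n satisfies all identities of P_m: as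
   R contains Q, the values at 0 of finitely many derivatives of the f_i can
   be prescribed, and a polynomial over R that vanishes at all points is zero.
   *)
Require Import Defs.
From HB Require Import structures.
From mathcomp Require Import all_boot all_order all_algebra.
From mathcomp Require Import finmap boolp.
From mathcomp Require Import mpoly.
From mathcomp Require Import monalg.

Set Implicit Arguments.
Unset Strict Implicit.
Unset Printing Implicit Defensive.

Import GRing.Theory.
Local Open Scope ring_scope.

(** * Free algebras of a variety generated by one algebra *)

Section Free.
Variable R : comNzRingType.

Lemma hom_eval (A B : algebra2 R) (f : A -> B) (v : nat -> A) (t : term R) :
  is_hom f -> f (eval v t) = eval (f \o v) t.
Proof.
move=> [fL fM fB]; have f0 : f 0 = 0.
  by have := fL (-1) 0 0; rewrite scaler0 add0r scaleN1r addNr.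
elim: t => [k||t1 IH1 t2 IH2|a t IH|t1 IH1 t2 IH2|t1 IH1 t2 IH2] //=.
- by have := fL 1 (eval v t1) (eval v t2); rewrite !scale1r IH1 IH2.
- by have := fL a (eval v t) 0; rewrite !addr0 f0 addr0 IH.
- by rewrite fM IH1 IH2.
- by rewrite fB IH1 IH2.
Qed.

(** Serves to merge variables that stand for the same generator, since terms have variables in [nat]
    while generators are indexed by [I]. *)
Fixpoint rename (s : nat -> nat) (t : term R) : term R :=
  match t with
  | TVar k => TVar R (s k)
  | TZero => TZero R
  | TAdd t1 t2 => TAdd (rename s t1) (rename s t2)
  | TScale a t1 => TScale a (rename s t1)
  | TMul t1 t2 => TMul (rename s t1) (rename s t2)
  | TBr t1 t2 => TBr (rename s t1) (rename s t2)
  end.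

Lemma eval_rename (A : algebra2 R) (s : nat -> nat) (v : nat -> A) t :
  eval v (rename s t) = eval (v \o s) t.
Proof.
elim: t => [k||t1 IH1 t2 IH2|a t IH|t1 IH1 t2 IH2|t1 IH1 t2 IH2] //=;
  by rewrite ?IH1 ?IH2 ?IH.
Qed.

(** Homomorphisms commute with evaluation, so each one sends every value of an identity of [B] to
    0. *)
Lemma Var_separated (A B : algebra2 R) :
  (forall x : A, (forall f : A -> B, is_hom f -> f x = 0) -> x = 0) ->
  Var B A.
Proof.
by move=> sep t tB v; apply: sep => f fhom; rewrite hom_eval // tB.
Qed.

Lemma generated_subalgebra (A : algebra2 R) (I : Type) (y : I -> A)
    (x : subalgebra y) : generated (subalgebra_gen y) x.
Proof.
case: x => x xP; have /gen_predP gx := xP.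
(* The membership proof is kept general, so that the induction runs in [A] while building elements
   of the subalgebra. *)
suff: forall xP : x \in gen_pred y,
    generated (subalgebra_gen y) (GenType xP : subalgebra y) by apply.
have gE a (aP aP' : a \in gen_pred y) :
    generated (subalgebra_gen y) (GenType aP : subalgebra y) ->
    generated (subalgebra_gen y) (GenType aP' : subalgebra y).
  by rewrite (bool_irrelevance aP aP').
elim: {x xP} gx => [i||a b ga IHa gb IHb|r a ga IHa|a b ga IHa gb IHb
    |a b ga IHa gb IHb] xP.
- exact: gE (gen_var _ i).
- have -> : (GenType xP : subalgebra y) = 0 by apply: val_inj.
  exact: gen_zero.
- have aP : a \in gen_pred y by apply/gen_predP.
  have bP : b \in gen_pred y by apply/gen_predP.
  have -> : (GenType xP : subalgebra y) =
      (GenType aP : subalgebra y) + GenType bP by apply: val_inj.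
  exact: gen_add.
- have aP : a \in gen_pred y by apply/gen_predP.
  have -> : (GenType xP : subalgebra y) = r *: (GenType aP : subalgebra y).
    exact: val_inj.
  exact: gen_scale.
- have aP : a \in gen_pred y by apply/gen_predP.
  have bP : b \in gen_pred y by apply/gen_predP.
  have -> : (GenType xP : subalgebra y) =
      amul (GenType aP : subalgebra y) (GenType bP) by apply: val_inj.
  exact: gen_mul.
- have aP : a \in gen_pred y by apply/gen_predP.
  have bP : b \in gen_pred y by apply/gen_predP.
  have -> : (GenType xP : subalgebra y) =
      abr (GenType aP : subalgebra y) (GenType bP) by apply: val_inj.
  exact: gen_br.
Qed.

Lemma subalgebra_val_hom (A : algebra2 R) (I : Type) (y : I -> A) :
  is_hom (fun x : subalgebra y => val x : A).
Proof. by split. Qed.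

Lemma comp_hom (A B C : algebra2 R) (f : A -> B) (g : B -> C) :
  is_hom f -> is_hom g -> is_hom (g \o f).
Proof.
move=> [fL fM fB] [gL gM gB]; split=> [r a b|a b|a b] /=.
- by rewrite fL gL.
- by rewrite fM gM.
- by rewrite fB gB.
Qed.

(** [ix] is a retraction of the numbering [xi] of [I], so variables in [nat] reach every
    generator. *)
Lemma generated_term (A : algebra2 R) (I : Type) (y : I -> A)
    (ix : nat -> I) (xi : I -> nat) (x : A) : cancel xi ix ->
  generated y x -> exists t : term R, eval (y \o ix) t = x.
Proof.
move=> xiK; elim=> {x} [i||a b _ [t <-] _ [u <-]|r a _ [t <-]
    |a b _ [t <-] _ [u <-]|a b _ [t <-] _ [u <-]].
- by exists (TVar R (xi i)); rewrite /= xiK.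
- by exists (TZero R).
- by exists (TAdd t u).
- by exists (TScale r t).
- by exists (TMul t u).
- by exists (TBr t u).
Qed.

Lemma hom_eq_generated (A B : algebra2 R) (I : Type) (y : I -> A)
    (f g : A -> B) (x : A) : is_hom f -> is_hom g ->
  (forall i, f (y i) = g (y i)) -> generated y x -> f x = g x.
Proof.
move=> fh gh fg; have t0 := hom_eval (fun=> 0) (TZero R).
have [[fL fM fB] [gL gM gB]] := (fh, gh).
have f0 := t0 _ _ _ fh; have g0 := t0 _ _ _ gh; rewrite /= in f0 g0.
elim=> {x} [i||a b _ IHa _ IHb|r a _ IHa|a b _ IHa _ IHb|a b _ IHa _ IHb].
- exact: fg.
- by rewrite f0 g0.
- by have := fL 1 a b; have := gL 1 a b; rewrite !scale1r IHa IHb => <-.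
- by have := fL r a 0; have := gL r a 0; rewrite !addr0 f0 g0 !addr0 IHa => <-.
- by rewrite fM gM IHa IHb.
- by rewrite fB gB IHa IHb.
Qed.

(** The map to [A] is defined by picking a term for each element of [F]; the pick is immaterial
    because any relation among the [y i] transfers to [A]. *)
Lemma is_free_criterion (B F : algebra2 R) (I : Type) (y : I -> F)
    (ix : nat -> I) (xi : I -> nat) : cancel xi ix ->
  (forall x : F, generated y x) ->
  (forall x : F, (forall f : F -> B, is_hom f -> f x = 0) -> x = 0) ->
  (forall b : I -> B, exists2 f : F -> B, is_hom f & forall i, f (y i) = b i) ->
  is_free (Var B) y.
Proof.
move=> xiK gen sep ext; split=> //; first exact: Var_separated.
move=> A a VA.
have rel0 t : eval (y \o ix) t = 0 -> eval (a \o ix) t = 0.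
  (* An identity must hold at arbitrary valuations, which may separate variables with the same image
     under [ix]. The renaming merges these, so every valuation factors through [I] and [ext]
     applies. *)
  move=> t0; suff tB : satisfies B (rename (xi \o ix) t).
    have := VA _ tB (a \o ix); rewrite eval_rename.
    by congr (eval _ _ = 0); apply: funext => k /=; rewrite xiK.
  move=> v; have [f fh fy] := ext (v \o xi).
  rewrite eval_rename -[v \o _]/((v \o xi) \o ix).
  have -> : (v \o xi) \o ix = f \o (y \o ix).
    by apply: funext => k /=; rewrite fy.
  rewrite -hom_eval // t0.
  exact: (hom_eval (fun=> 0) (TZero R) fh).
have rel t u : eval (y \o ix) t = eval (y \o ix) u ->
    eval (a \o ix) t = eval (a \o ix) u.
  move=> tu; apply/eqP; rewrite -subr_eq0 -scaleN1r; apply/eqP.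
  apply: (rel0 (TAdd t (TScale (-1) u))).
  by rewrite /= tu scaleN1r subrr.
have /choice[T TE] : forall x, exists t, eval (y \o ix) t = x.
  by move=> x; apply: generated_term xiK (gen x).
pose f x := eval (a \o ix) (T x).
have fh : is_hom f.
  (* Each law compares two terms with equal values in [F]. *)
  split=> [r x z|x z|x z].
  - rewrite -[RHS]/(eval _ (TAdd (TScale r (T x)) (T z))).
    by apply: rel => /=; rewrite !TE.
  - rewrite -[RHS]/(eval _ (TMul (T x) (T z))).
    by apply: rel => /=; rewrite !TE.
  - rewrite -[RHS]/(eval _ (TBr (T x) (T z))).
    by apply: rel => /=; rewrite !TE.
have fy i : f (y i) = a i.
  have -> : a i = eval (a \o ix) (TVar R (xi i)) by rewrite /= xiK.
  by apply: rel; rewrite TE /= xiK.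
exists f; split=> // g gh gy x.
by apply: (hom_eq_generated gh fh) (gen x) => i; rewrite gy fy.
Qed.

End Free.

(** * From differential to Poisson homomorphisms *)

Lemma poisson_hom (R : comNzRingType) (m : nat) (A B : diffAlgebra R m.*2)
    (phi : {linear A -> B}) :
  {morph phi : a b / a * b} ->
  (forall k a, phi (der A k a) = der B k (phi a)) ->
  @is_hom R (poisson A) (poisson B) phi.
Proof.
move=> phiM phiD; split=> [||a b]; [exact: linearP|exact: phiM|].
rewrite /= /dbracket raddf_sum; apply: eq_bigr => i _.
by rewrite raddfB /= !phiM !phiD.
Qed.

(** * Univariate polynomials over a ring containing the rationals *)

Section RationalPoints.
Variables (R : comNzRingType) (iota : {rmorphism rat -> R}).

Lemma rat_nat_inv (k : nat) : (k != 0)%N -> iota k%:R^-1 * k%:R = 1.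
Proof.
move=> k0; rewrite -(rmorph_nat iota) -rmorphM mulVf ?rmorph1 //.
by rewrite Num.Theory.pnatr_eq0.
Qed.

(** [R] may have zero divisors, but differences of distinct naturals are units by [iota]; so once
    ['X - k] is split off, the other points are roots of the cofactor. *)
Lemma poly_nat_roots_eq0 (s : seq nat) (q : {poly R}) : uniq s ->
  {in s, forall k, q.[k%:R] = 0} -> (size q <= size s)%N -> q = 0.
Proof.
elim: s q => [|k s IH] q /=.
  by move=> _ _; rewrite leqn0 size_poly_eq0 => /eqP.
case/andP=> kNs us q0 szq.
have /factor_theorem[r rE] : root q k%:R.
  by rewrite /root q0 // mem_head.
suff r0 : r = 0 by rewrite rE r0 mul0r.
have [//|nzr] := eqVneq r 0.
apply: IH => // [j js|]; last first.
  by move: szq; rewrite rE size_Mmonic ?monicXsubC // size_XsubC addn2.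
have jk : j != k by apply: contraNneq kNs => <-.
have jks : j \in k :: s by rewrite inE js orbT.
have := q0 j jks; rewrite rE hornerM hornerXsubC => rj0.
have e : ((j%:R - k%:R) * iota (j%:R - k%:R)^-1 : R) = 1.
  rewrite -!(rmorph_nat iota) -rmorphB -rmorphM mulfV ?rmorph1 //.
  by rewrite subr_eq0 Num.Theory.eqr_nat.
by rewrite -[LHS]mulr1 -[X in _ * X]e mulrA rj0 mul0r.
Qed.

End RationalPoints.

(** * Evaluation of commutative monomials *)

Section CmonomEval.
Variable I : choiceType.

Lemma cmonom_ind (P : {cmonom I} -> Prop) :
  P mone -> (forall v mu, P mu -> P (mmul (ucm v) mu)) -> forall mu, P mu.
Proof.
move=> P1 PM mu.
have [d] := ubnP (mdeg mu); elim: d mu => [mu|d IH mu].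
  by rewrite ltn0.
rewrite ltnS => le.
have [->//|nmu] := eqVneq mu mone.
have [v vmu] : exists v, v \in finsupp mu.
  apply/fset0Pn; apply: contra nmu => /eqP e; rewrite -mdeg_eq0 mdegE e.
  by rewrite big_seq_fset0.
(* [divcm] truncates, so the equality at [v] relies on [v] occurring in [mu]. *)
have e : mu = mmul (ucm v) (divcm mu (ucm v)).
  apply/eqP/cmP => w; rewrite cmM divcmE cmU.
  by case: eqP => [<-|_]; [rewrite subnKC // lt0n cmE_neq0 | rewrite subn0].
rewrite e; apply/PM/IH; rewrite (leq_trans _ le) //.
by rewrite [in X in (_ < X)%N]e mdegM mdegU add1n.
Qed.

Section Eval.
Variables (S : comNzRingType) (h : I -> S).

Definition cmeval (mu : {cmonom I}) : S :=
  \prod_(v <- finsupp mu) h v ^+ mu v.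

(** Variables outside the support contribute the factor 1, which lets several monomials share one
    index set. *)
Lemma cmevalE (d : {fset I}) (mu : {cmonom I}) : (finsupp mu `<=` d)%fset ->
  cmeval mu = \prod_(v <- d) h v ^+ mu v.
Proof.
move=> le; rewrite /cmeval (big_fset_incl _ le) // => v _.
by rewrite -cmE_eq0 => /eqP ->.
Qed.

Lemma cmeval_mmorphism : mmorphism cmeval.
Proof.
split=> [mu nu|]; last by rewrite /cmeval mdom1 big_seq_fset0.
have lm : (finsupp mu `<=` finsupp mu `|` finsupp nu)%fset by apply: fsubsetUl.
have ln : (finsupp nu `<=` finsupp mu `|` finsupp nu)%fset by apply: fsubsetUr.
rewrite (cmevalE lm) (cmevalE ln) (@cmevalE (finsupp mu `|` finsupp nu)%fset).
  by rewrite -big_split; apply: eq_bigr => v _ /=; rewrite cmM exprD.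
by rewrite mdomD.
Qed.

HB.instance Definition _ := isMultiplicative.Build _ _ cmeval cmeval_mmorphism.

Lemma cmevalU v : cmeval (ucm v) = h v.
Proof. by rewrite /cmeval mdomU big_seq_fset1 cmUU expr1. Qed.

End Eval.

Lemma cmeval_comp (S S' : comNzRingType) (g : {rmorphism S -> S'}) h mu :
  g (cmeval h mu) = cmeval (g \o h) mu.
Proof. by rewrite rmorph_prod; apply: eq_bigr => v _; rewrite rmorphXn. Qed.

Lemma eq_cmeval (S : comNzRingType) (h h' : I -> S) (mu : {cmonom I}) :
  {in finsupp mu, h =1 h'} -> cmeval h mu = cmeval h' mu.
Proof. by move=> e; apply: eq_big_seq => v /e ->. Qed.

Lemma cmevalXn (S : comNzRingType) (x : S) (w : I -> nat) (d : {fset I})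
    (mu : {cmonom I}) :
  (finsupp mu `<=` d)%fset ->
  cmeval (fun v => x ^+ w v) mu = x ^+ (\sum_(v <- d) w v * mu v)%N.
Proof.
move=> le; rewrite (cmevalE _ le) expr_sum.
by apply: eq_bigr => v _; rewrite exprM.
Qed.

(* Kronecker's substitution: the mu v become the digits in base B of the sum. *)
Lemma separating_weight (d : seq I) (B : nat) : uniq d ->
  exists w : I -> nat, forall mu nu : I -> nat,
    {in d, forall v, mu v < B}%N -> {in d, forall v, nu v < B}%N ->
    (\sum_(v <- d) w v * mu v = \sum_(v <- d) w v * nu v)%N ->
    {in d, mu =1 nu}.
Proof.
elim: d => [|u d IH] /=; first by exists (fun=> 0)%N.
case/andP=> uNd /IH[w wP].
exists (fun v => if v == u then 1 else B * w v)%N => mu nu muB nuB.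
have E (g : I -> nat) :
    (\sum_(v <- u :: d) (if v == u then 1 else B * w v) * g v =
     (\sum_(v <- d) w v * g v) * B + g u)%N.
  rewrite big_cons eqxx mul1n addnC big_distrl /=; congr (_ + _)%N.
  apply: eq_big_seq => v vd; rewrite ifN; first by rewrite -mulnA mulnC.
  by apply: contraNneq uNd => <-.
rewrite !E => e.
have muu := muB u (mem_head _ _); have nuu := nuB u (mem_head _ _).
have B0 : (0 < B)%N by apply: leq_ltn_trans muu.
have eu : mu u = nu u.
  by have /(congr1 (modn^~ B)) := e; rewrite !modnMDl !modn_small.
move=> v; rewrite inE => /orP[/eqP->//|vd].
apply: wP vd => [x xd|x xd|].
- by apply: muB; rewrite inE xd orbT.
- by apply: nuB; rewrite inE xd orbT.
- by have /(congr1 (divn^~ B)) := e; rewrite !divnMDl // !divn_small // !addn0.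
Qed.

End CmonomEval.

(** * Polynomials vanishing at all points *)

Section Vanishing.
Variables (R : comNzRingType) (iota : {rmorphism rat -> R}) (I : choiceType).

Lemma mmap_rmorph (S S' : comNzRingType) (f : {rmorphism R -> S})
    (g : {rmorphism S -> S'}) (h : I -> S) (p : {malg R[{cmonom I}]}) :
  g (mmap f (cmeval h) p) = mmap (g \o f) (cmeval (g \o h)) p.
Proof.
rewrite /mmap rmorph_sum; apply: eq_bigr => mu _.
by rewrite rmorphM cmeval_comp.
Qed.

(** Kronecker's substitution turns [p] into a univariate polynomial with the same nonzero
    coefficients, whose values at naturals are values of [p]. *)
Lemma mmap_eval_eq0 (p : {malg R[{cmonom I}]}) :
  (forall h : I -> R, mmap idfun (cmeval h) p = 0) -> p = 0.
Proof.
move=> p0; pose d := (\bigcup_(mu <- msupp p) finsupp (mu : {cmonom I}))%fset.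
have led mu : mu \in msupp p -> (finsupp mu `<=` d)%fset.
  move=> mup; apply/fsubsetP => v vmu; apply/bigfcupP; exists mu => //.
  by rewrite mup.
(* Every exponent is at most the degree of its monomial, hence a digit in base [B]. *)
pose B := (\max_(mu <- msupp p) mdeg mu).+1.
have ltB mu v : mu \in msupp p -> (mu v < B)%N.
  move=> mup; rewrite ltnS; apply: (@leq_trans (mdeg mu)); last first.
    exact: leq_bigmax_seq.
  have [vmu|] := boolP (v \in finsupp mu); last by rewrite -cmE_eq0 => /eqP->.
  by rewrite mdegE (big_fsetD1 v) //= leq_addr.
have [w wP] := separating_weight B (fset_uniq d).
pose W (mu : {cmonom I}) := (\sum_(v <- d) w v * mu v)%N.
have Winj : {in msupp p &, injective W}.
  move=> mu nu mup nup e; apply/eqP/cmP => v.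
  have [vd|vNd] := boolP (v \in d); first by apply: wP vd => // u _; apply: ltB.
  have z la : la \in msupp p -> la v = 0%N.
    move=> lap; apply/eqP; rewrite cmE_eq0; apply: contra vNd.
    by apply/fsubsetP/led.
  by rewrite !z.
pose q : {poly R} := mmap polyC (cmeval (fun v => 'X^(w v))) p.
have qE : q = \sum_(mu <- msupp p) (mcoeff mu p)%:P * 'X^(W mu).
  rewrite /q /mmap; apply: eq_big_seq => mu mup.
  by rewrite (cmevalXn _ _ (led _ mup)).
have q0 : q = 0.
  apply: (poly_nat_roots_eq0 iota (iota_uniq 0 (size q))) => [k _|].
    rewrite -[LHS]/(horner_eval k%:R q) mmap_rmorph.
    (* The value of [q] at [k] is that of [p] at the point with coordinates [k ^ w v]. *)
    rewrite -[RHS](p0 (fun v => k%:R ^+ w v)).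
    rewrite /mmap; apply: eq_bigr => mu _; congr (_ * _).
      by rewrite /= /horner_eval hornerC.
    congr (cmeval _ mu); apply: funext => v.
    by rewrite /= /horner_eval hornerXn.
  by rewrite size_iota.
apply/malgP => mu; rewrite mcoeff0.
have [mup|/mcoeff_outdom//] := boolP (mu \in msupp p).
(* By [Winj], the coefficient at [W mu] comes from [mu] alone. *)
have := congr1 (fun r : {poly R} => r`_(W mu)) q0.
rewrite coef0 qE coef_sum (big_fsetD1 mu) //= coefCM coefXn eqxx mulr1.
rewrite big_seq big1 ?addr0 // => nu; rewrite in_fsetD1 => /andP[nm nup].
rewrite coefCM coefXn; case: eqP => [e|]; last by rewrite mulr0.
by rewrite (Winj _ _ mup nup e) eqxx in nm.
Qed.

End Vanishing.

(** * Differential substitutions *)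

Section Intertwine.
Variables (R : comNzRingType) (A B : comAlgType R).
Variables (phi : {linear A -> B}) (D : {linear A -> A}) (D' : {linear B -> B}).

(** [A_ind] says that [M] spans [A], and both composites are linear. *)
Lemma intertwine_ext (T : Type) (M : T -> A)
    (A_ind : forall P : A -> Prop, P 0 ->
       (forall a b, P a -> P b -> P (a + b)) ->
       (forall r a, P a -> P (r *: a)) ->
       (forall t, P (M t)) -> forall a, P a) :
  (forall t, phi (D (M t)) = D' (phi (M t))) ->
  forall a, phi (D a) = D' (phi a).
Proof.
move=> H a; elim/A_ind: a => [|a b IHa IHb|r a IHa|t]; last exact: H.
- by rewrite !raddf0.
- by rewrite !raddfD /= IHa IHb.
- by rewrite !linearZ /= IHa.
Qed.

Lemma intertwine_mul (a b : A) : {morph phi : x y / x * y} ->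
  (forall x y, D (x * y) = D x * y + x * D y) ->
  (forall x y, D' (x * y) = D' x * y + x * D' y) ->
  phi (D a) = D' (phi a) -> phi (D b) = D' (phi b) ->
  phi (D (a * b)) = D' (phi (a * b)).
Proof.
by move=> phiM DM D'M ha hb; rewrite phiM DM D'M raddfD /= !phiM ha hb.
Qed.

End Intertwine.

Section Substitution.
Variables (R : comNzRingType) (n q : nat) (f : 'I_n -> mpoly q R).

(** This value is forced by commutation with the derivations once [y_i] is sent to [f i]. *)
Definition dsubst_var (v : dvar n q) : mpoly q R := mderivm v.2 (f v.1).

Definition dsubst (p : {malg R[{cmonom (dvar n q)}]}) : mpoly q R :=
  mmap (@mpolyC q R) (cmeval dsubst_var) p.

Lemma dsubst_linear : linear dsubst.
Proof.
move=> r a b.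
rewrite /dsubst [LHS]mmapD; congr (_ + _).
by rewrite [LHS]mmapZ mul_mpolyC.
Qed.

HB.instance Definition _ :=
  GRing.isLinear.Build R {malg R[{cmonom (dvar n q)}]} (mpoly q R) *:%R dsubst
    dsubst_linear.

Lemma dsubstM : {morph dsubst : a b / a * b}.
Proof. exact: (rmorphM (mmap (@mpolyC q R) (cmeval dsubst_var))). Qed.

Lemma dsubst_dX v : dsubst (dX R v) = dsubst_var v.
Proof. by rewrite /dsubst /dX mmapU cmevalU /= mpolyC1 mul1r. Qed.

(** The Leibniz rule propagates the equality from single variables to monomials, and linearity from
    these to all of the algebra. *)
Lemma dsubst_der k (a : {malg R[{cmonom (dvar n q)}]}) :
  dsubst (dder k a) = mderiv k (dsubst a).
Proof.
apply: (@intertwine_ext R {malg R[{cmonom (dvar n q)}]} (mpoly q R)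
  dsubst (dder k) (mderiv k) _ _ (@dpoly_ind R n q)).
apply: cmonom_ind => [|v mu IH].
  rewrite /= [X in dsubst X]dder_1 raddf0.
  by rewrite /dsubst mmapU (cmeval_mmorphism _).2 /= mulr1 mderivC.
rewrite dmonM; apply: (@intertwine_mul R {malg R[{cmonom (dvar n q)}]}
  (mpoly q R) dsubst (dder k) (mderiv k)) IH.
- exact: dsubstM.
- exact: dder_leibniz.
- exact: mderivM.
rewrite /= -/(dX R v) [X in dsubst X]dder_X.
rewrite [X in X = _]dsubst_dX [X in _ = mderiv _ X]dsubst_dX /dsubst_var /=.
(* Adding [delta_k] to the multi-index amounts to one more derivative in direction [k]. *)
by rewrite /delta_mul addmC mderivmDm mderivmU1m.
Qed.

End Substitution.

(** * Prescribed derivatives at the origin and separation of points *)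

Section Taylor.
Variables (R : comNzRingType) (iota : {rmorphism rat -> R}) (n q : nat).

(** The witness [f i] is a truncated Taylor expansion with coefficients [h (i, mu) / mu!]; [d] being
    finite, the orders involved are bounded by [k]. *)
Lemma taylor_interpolation (d : seq (dvar n q)) (h : dvar n q -> R) :
  exists f : 'I_n -> mpoly q R,
    {in d, forall v, mpoly.mcoeff 0%MM (dsubst_var f v) = h v}.
Proof.
pose k := (\max_(v <- d) mpoly.mdeg (v.2 : multinom q)).+1.
pose c (mu : multinom q) := (\prod_(j < q) (mu j)`!)%N.
exists (fun i => \sum_(mu : 'X_{1..q < k})
   (h (i, bmnm mu) * iota (c (bmnm mu))%:R^-1) *: mpolyX R (bmnm mu)) => v vd.
have vk : (mpoly.mdeg (v.2 : multinom q) < k)%N.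
  rewrite ltnS; exact: (@leq_bigmax_seq _ d xpredT
    (fun v : dvar n q => mpoly.mdeg (v.2 : multinom q))).
rewrite /dsubst_var mcoeff_mderivm addm0.
rewrite (@mcoeff_mpoly _ _ (fun mu => h (v.1, mu) * iota (c mu)%:R^-1) _ _ vk).
(* Differentiating the monomial of exponent [mu] by [mu] itself leaves [mu!], which cancels the
   denominator. *)
under eq_bigr do rewrite ffactnn.
rewrite -/(c _) -[LHS]mulr_natr -mulrA rat_nat_inv ?mulr1; first by case: (v).
by rewrite -lt0n prodn_gt0 // => j; apply: fact_gt0.
Qed.

(** The constant term of [dsubst f p] is the value of [p] at the derivatives of the [f i] at 0, and
    interpolation makes these agree with any [h] on the variables of [p]. *)
Lemma dsubst_separates (p : {malg R[{cmonom (dvar n q)}]}) :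
  (forall f : 'I_n -> mpoly q R, dsubst f p = 0) -> p = 0.
Proof.
move=> p0; apply: (mmap_eval_eq0 iota) => h.
pose d := (\bigcup_(mu <- msupp p) finsupp (mu : {cmonom (dvar n q)}))%fset.
have [f fh] := taylor_interpolation d h.
have <- : mpoly.mcoeff 0%MM (dsubst f p) = mmap idfun (cmeval h) p.
  rewrite [LHS](@mmap_rmorph _ _ _ _ _ (mpoly.mcoeff 0%MM)) /mmap.
  apply: eq_big_seq => mu mup; rewrite /= mpolyCK; congr (_ * _).
  apply: eq_cmeval => v vmu; apply: fh.
  by apply/bigfcupP; exists mu; rewrite ?mup.
by rewrite p0 mpoly.mcoeff0.
Qed.

End Taylor.

(** * Restriction to the Poisson subalgebra and freeness *)

Lemma dsubst_is_hom (R : comNzRingType) (m n : nat)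
    (f : 'I_n -> mpoly m.*2 R) :
  @is_hom R (poisson (diffPoly R n m.*2)) (symplectic R m) (dsubst f).
Proof.
apply: (@poisson_hom R m (diffPoly R n m.*2) (polyDiff R m) (dsubst f)).
- exact: dsubstM.
- exact: dsubst_der.
Qed.

Theorem theorem5 (R : comNzRingType) (iota : {rmorphism rat -> R})
    (m n : nat) (hm : (0 < m)%N) (hn : (0 < n)%N) :
  is_free (Var (symplectic R m)) (@Pn_var R m n).
Proof.
pose C := poisson (diffPoly R n m.*2).
pose res f (x : Pn R m n) : symplectic R m := dsubst f (val x : C).
have res_hom f : is_hom (res f).
  exact: comp_hom (subalgebra_val_hom _) (dsubst_is_hom f).
apply: (@is_free_criterion R (symplectic R m) (Pn R m n) 'I_n (@Pn_var R m n)
  (* Naturals not below [n] are sent to the default index 0, which exists by [hn]. *)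
  (insubd (Ordinal hn)) val); first exact: valKd.
- exact: generated_subalgebra.
- move=> x x0; apply: val_inj; apply: (dsubst_separates iota) => f.
  exact: (x0 _ (res_hom f)).
- move=> b; exists (res b) => // i.
  (* The generator carries the multi-index 0, so no derivative is taken. *)
  by rewrite [LHS]dsubst_dX /dsubst_var mderivm0m.
Qed.
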